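(* Let $\mathcal{A}$ be a separable $C^*$-algebra, let $\pi_0\colon\mathcal{A}\to\mathcal{B}(\mathcal{H}_0)$ be a $*$-representation with kernel $\mathcal{P}_0:=\mathrm{Ker}\,\pi_0$ and $\mathcal{K}(\mathcal{H}_0)\subseteq\pi_0(\mathcal{A})\ne\{0\}$, such that $\{\mathcal{P}_0\}$ is an open subset of $\mathrm{Prim}(\mathcal{A})$, and let $\mathcal{J}_0\subseteq\mathcal{A}$ be the closed two-sided ideal for which $\pi_0|_{\mathcal{J}_0}\colon\mathcal{J}_0\to\mathcal{K}(\mathcal{H}_0)$ is a $*$-isomorphism. Assume additionally that (i) $\mathcal{A}$ is a ''real'' $C^*$-algebra; (ii) $\mathcal{P}_0\cap\overline{\mathcal{P}_0}=\{0\}$; (iii) if $p\in\mathcal{J}_0$ is a minimal projection, then $K_0(\mathcal{A})=\{n[p]_0\mid n\in\mathbb{Z}\}$; (iv) there exists a projection in $\mathcal{A}$ that does not belong to $\mathcal{J}_0+\overline{\mathcal{J}_0}$. Then $\mathcal{A}$ is not stably finite.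
   Context: $\mathcal{K}(\mathcal{H}_0)$ denotes the compact operators on $\mathcal{H}_0$, and $\mathrm{Prim}(\mathcal{A})$ the primitive ideal space with the hull-kernel topology. Under the stated assumptions, openness of $\{\mathcal{P}_0\}$ is equivalent to the existence of the ideal $\mathcal{J}_0$, and $\mathcal{J}_0$ is uniquely determined as the intersection of all $\mathcal{P}\in\mathrm{Prim}(\mathcal{A})\setminus\{\mathcal{P}_0\}$ (the empty intersection being $\mathcal{A}$). A ''real'' $C^*$-algebra is a $C^*$-algebra with a fixed antilinear map $a\mapsto\overline{a}$ satisfying $\overline{ab}=\overline{a}\,\overline{b}$, $\overline{a^*}=\overline{a}^*$, $\overline{\overline{a}}=a$; for a subset $S\subseteq\mathcal{A}$, $\overline{S}:=\{\overline{a}\mid a\in S\}$. A projection is a self-adjoint idempotent. A $C^*$-algebra $\mathcal{A}$ with unitization $\widetilde{\mathcal{A}}=\mathbb{C}\mathbf{1}\dotplus\mathcal{A}$ is stably finite if for every $r\ge1$, every $v\in M_r(\widetilde{\mathcal{A}})$ with $vv^*=\mathbf{1}_r$ satisfies $v^*v=\mathbf{1}_r$. *)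

(* Defs.v *)
From HB Require Import structures.
From mathcomp Require Import all_boot all_order all_algebra generic_quotient.
From mathcomp Require Import complex.
From mathcomp Require Import boolp classical_sets functions cardinality reals.
From mathcomp Require Import topology normedtype.

Set Implicit Arguments.
Unset Strict Implicit.
Unset Printing Implicit Defensive.

Import Order.TTheory GRing.Theory Num.Theory numFieldNormedType.Exports.

Local Open Scope quotient_scope.
Local Open Scope classical_set_scope.
Local Open Scope ring_scope.

(* MathComp rings are unital, so the product of a possibly non-unital
   C*-algebra is an operation on a complex Banach space. *)
HB.mixin Record isCStarAlgebra (R : realType) A
    of CompleteNormedModule R[i] A := {
  cmul : A -> A -> A;
  cstar : A -> A;
  cmulA : associative cmul;
  cmulDl : left_distributive cmul +%R;
  cmulDr : right_distributive cmul +%R;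
  cmulZl : forall (c : R[i]) a b, cmul (c *: a) b = c *: cmul a b;
  cmulZr : forall (c : R[i]) a b, cmul a (c *: b) = c *: cmul a b;
  cstarD : {morph cstar : a b / a + b};
  cstarZ : forall (c : R[i]) a, cstar (c *: a) = c^* *: cstar a;
  cstarM : forall a b, cstar (cmul a b) = cmul (cstar b) (cstar a);
  cstarK : involutive cstar;
  cnormM : forall a b, `|cmul a b| <= `|a| * `|b|;
  cnorm_star : forall a, `|cmul (cstar a) a| = `|a| ^+ 2
}.

#[short(type="cstarAlgType")]
HB.structure Definition CStarAlgebra (R : realType) :=
  {A of isCStarAlgebra R A & CompleteNormedModule R[i] A}.

HB.mixin Record isHilbertSpace (R : realType) H
    of CompleteNormedModule R[i] H := {
  hdot : {dot H for (@Num.conj R[i])};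
  hdotE : forall x : H, `|x| ^+ 2 = hdot x x
}.

#[short(type="hilbertType")]
HB.structure Definition HilbertSpace (R : realType) :=
  {H of isHilbertSpace R H & CompleteNormedModule R[i] H}.

Definition separable (T : topologicalType) : Prop :=
  exists2 D : set T, countable D & dense D.

Section Operators.
Variables (R : realType) (H : hilbertType R).

Definition bounded_operator : set (H -> H) :=
  [set T | linear T /\ continuous T].

Definition compact_operator : set (H -> H) :=
  [set T | bounded_operator T /\ precompact (T @` [set x | `|x| <= 1])].

End Operators.

Arguments bounded_operator {R} H.
Arguments compact_operator {R} H.

Section PrimitiveIdeals.
Variables (R : realType) (A : cstarAlgType R).

Record star_representation (H : hilbertType R) (pi : A -> H -> H) : Prop := {
  rep_bounded : forall a, bounded_operator H (pi a);
  rep_linear : linear pi;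
  repM : forall a b, pi (cmul a b) = pi a \o pi b;
  rep_star : forall a x y, hdot (pi a x) y = hdot x (pi (cstar a) y)
}.

Definition rep_ker (H : hilbertType R) (pi : A -> H -> H) : set A :=
  [set a | pi a = 0].

Definition closed_subspace (V : completeNormedModType R[i]) (W : set V) : Prop :=
  [/\ closed W, W 0 & forall (c : R[i]) x y, W x -> W y -> W (c *: x + y)].

Definition irreducible (H : hilbertType R) (pi : A -> H -> H) : Prop :=
  pi <> 0 /\
  forall W : set H, closed_subspace W ->
    (forall a x, W x -> W (pi a x)) -> W = [set 0] \/ W = setT.

Definition closed_ideal (J : set A) : Prop :=
  closed_subspace J /\
  forall a b, J b -> J (cmul a b) /\ J (cmul b a).

Definition Prim : set (set A) :=
  [set P | exists (H : hilbertType R) (pi : A -> H -> H),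
     [/\ star_representation pi, irreducible pi & P = rep_ker pi]].

Definition hk_closure (F : set (set A)) : set (set A) :=
  [set P | Prim P /\ \bigcap_(Q in F) Q `<=` P].

Definition hk_closed (F : set (set A)) : Prop :=
  F `<=` Prim /\ hk_closure F = F.

Definition hk_open (U : set (set A)) : Prop :=
  U `<=` Prim /\ hk_closed (Prim `\` U).

Definition is_projection (p : A) : Prop := cmul p p = p /\ cstar p = p.

Definition minimal_projection (p : A) : Prop :=
  [/\ is_projection p, p <> 0 &
      forall q, is_projection q -> cmul p q = q -> q = 0 \/ q = p].

Definition sum_set (S T : set A) : set A :=
  [set a | exists s t, [/\ S s, T t & a = s + t]].

Record real_structure (bar : A -> A) : Prop := {
  barD : {morph bar : a b / a + b};
  barZ : forall (c : R[i]) a, bar (c *: a) = c^* *: bar a;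
  barM : {morph bar : a b / cmul a b};
  bar_star : forall a, bar (cstar a) = cstar (bar a);
  barK : involutive bar
}.

End PrimitiveIdeals.

Arguments Prim {R} A.

HB.mixin Record isStarRing B of GRing.PzRing B := {
  star : B -> B;
  starD : {morph star : a b / a + b};
  starM : forall a b : B, star (a * b) = star b * star a;
  starK : involutive star
}.

#[short(type="starRingType")]
HB.structure Definition StarRing := {B of isStarRing B & GRing.PzRing B}.

HB.mixin Record isStarMorphism (B C : starRingType) (f : B -> C) := {
  map_star : {morph f : b / star b}
}.

#[short(type="starMorphism")]
HB.structure Definition StarMorphism (B C : starRingType) :=
  {f of @isStarMorphism B C f & @GRing.RMorphism B C f}.

Section ComplexStarRing.
Variable R : realType.

Fact conjD (a b : R[i]) : (a + b)^* = a^* + b^*.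
Proof. exact: rmorphD. Qed.

Fact conj_starM (a b : R[i]) : (a * b)^* = b^* * a^*.
Proof. by rewrite rmorphM mulrC. Qed.

HB.instance Definition _ := isStarRing.Build R[i] conjD conj_starM conjCK.

End ComplexStarRing.

(* The unitization always adjoins a new unit, even to a unital algebra. *)
Definition unitization (R : realType) (A : cstarAlgType R) : Type :=
  (R[i] * A)%type.

Section Unitization.
Variables (R : realType) (A : cstarAlgType R).
Local Notation U := (unitization A).

HB.instance Definition _ := GRing.Zmodule.copy U (R[i] * A)%type.

Definition uone : U := (1, 0).
Definition umul (x y : U) : U :=
  (x.1 * y.1, x.1 *: y.2 + y.1 *: x.2 + cmul x.2 y.2).
Definition ustar (x : U) : U := (x.1^*, cstar x.2).

Lemma cmul0r (a : A) : cmul 0 a = 0.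
Proof. by have := cmulZl 0 0 a; rewrite !scale0r. Qed.

Lemma cmulr0 (a : A) : cmul a 0 = 0.
Proof. by have := cmulZr 0 a 0; rewrite !scale0r. Qed.

Fact umulA : associative umul.
Proof.
move=> x y z; rewrite /umul /=; congr pair; first by rewrite mulrA.
rewrite !(cmulDl, cmulDr, cmulZl, cmulZr, scalerDr, scalerA, cmulA) -!addrA.
rewrite [z.1 * x.1]mulrC [z.1 * y.1]mulrC; congr (_ + (_ + _)).
rewrite addrCA [in RHS](addrCA (z.1 *: _)); congr (_ + (_ + _)).
exact: addrCA.
Qed.

Fact umul1x : left_id uone umul.
Proof. by case=> c a; rewrite /umul /= mul1r scale1r scaler0 cmul0r !addr0. Qed.

Fact umulx1 : right_id uone umul.
Proof. by case=> c a; rewrite /umul /= mulr1 scale1r scaler0 cmulr0 add0r addr0. Qed.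

Fact umulDl : left_distributive umul +%R.
Proof.
move=> x y z; rewrite /umul /=; congr pair; first by rewrite mulrDl.
rewrite scalerDl scalerDr cmulDl [RHS]addrACA; congr (_ + _).
exact: addrACA.
Qed.

Fact umulDr : right_distributive umul +%R.
Proof.
move=> x y z; rewrite /umul /=; congr pair; first by rewrite mulrDr.
rewrite scalerDl scalerDr cmulDr [RHS]addrACA; congr (_ + _).
exact: addrACA.
Qed.

HB.instance Definition _ :=
  GRing.Zmodule_isPzRing.Build U umulA umul1x umulx1 umulDl umulDr.

Fact ustarD : {morph ustar : x y / x + y}.
Proof. by move=> x y; rewrite /ustar /= rmorphD cstarD. Qed.

Fact ustarM (x y : U) : ustar (x * y) = ustar y * ustar x.
Proof.
rewrite /ustar; congr pair; first by rewrite rmorphM mulrC.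
by rewrite /= !cstarD !cstarZ cstarM; congr (_ + _); exact: addrC.
Qed.

Fact ustarK : involutive ustar.
Proof. by case=> c a; rewrite /ustar /= conjCK cstarK. Qed.

HB.instance Definition _ := isStarRing.Build U ustarD ustarM ustarK.

Definition uinj (a : A) : U := (0, a).

Definition scalar_part (x : U) : R[i] := x.1.

Fact scalar_part_additive : zmod_morphism scalar_part.
Proof. by []. Qed.

Fact scalar_part_monoid : monoid_morphism scalar_part.
Proof. by []. Qed.

Fact scalar_part_star : {morph scalar_part : x / star x}.
Proof. by []. Qed.

HB.instance Definition _ :=
  GRing.isZmodMorphism.Build U R[i] scalar_part scalar_part_additive.
HB.instance Definition _ :=
  GRing.isMonoidMorphism.Build U R[i] scalar_part scalar_part_monoid.
HB.instance Definition _ :=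
  isStarMorphism.Build U R[i] scalar_part scalar_part_star.

End Unitization.

Section Adjoint.
Variable B : starRingType.

Definition mxadj m n (M : 'M[B]_(m, n)) : 'M[B]_(n, m) := map_mx star M^T.

Definition mx_projection n (p : 'M[B]_n) : Prop := p *m p = p /\ mxadj p = p.

Definition mvn m n (p : 'M[B]_m) (q : 'M[B]_n) : Prop :=
  exists v : 'M[B]_(n, m), mxadj v *m v = p /\ v *m mxadj v = q.

Lemma star0 : star (0 : B) = 0.
Proof. by apply: (addrI (star 0)); rewrite -starD !addr0. Qed.

Lemma star_sum (I : finType) (F : I -> B) :
  star (\sum_i F i) = \sum_i star (F i).
Proof.
by apply: (big_morph (@star B)) => [x y|]; [exact: starD|exact: star0].
Qed.

Lemma mxadjK m n : cancel (@mxadj m n) (@mxadj n m).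
Proof. by move=> M; apply/matrixP => i j; rewrite !mxE starK. Qed.

Lemma mxadj0 m n : mxadj (0 : 'M[B]_(m, n)) = 0.
Proof. by apply/matrixP => i j; rewrite !mxE star0. Qed.

Lemma mxadjM m n p (M : 'M[B]_(m, n)) (N : 'M[B]_(n, p)) :
  mxadj (M *m N) = mxadj N *m mxadj M.
Proof.
apply/matrixP => i j; rewrite !mxE star_sum.
by apply: eq_bigr => k _; rewrite !mxE starM.
Qed.

Lemma mxadj_block m1 m2 n1 n2 (a : 'M[B]_(m1, n1)) (b : 'M[B]_(m1, n2))
    (c : 'M[B]_(m2, n1)) (d : 'M[B]_(m2, n2)) :
  mxadj (block_mx a b c d) = block_mx (mxadj a) (mxadj c) (mxadj b) (mxadj d).
Proof. by rewrite /mxadj tr_block_mx map_block_mx. Qed.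

Lemma mxadj_col m1 m2 n (a : 'M[B]_(m1, n)) (b : 'M[B]_(m2, n)) :
  mxadj (col_mx a b) = row_mx (mxadj a) (mxadj b).
Proof. by rewrite /mxadj tr_col_mx map_row_mx. Qed.

Definition dsum m n (p : 'M[B]_m) (q : 'M[B]_n) : 'M[B]_(m + n) :=
  block_mx p 0 0 q.

Lemma mx_projection_dsum m n (p : 'M[B]_m) (q : 'M[B]_n) :
  mx_projection p -> mx_projection q -> mx_projection (dsum p q).
Proof.
move=> [pp pE] [qq qE]; split; last by rewrite mxadj_block pE qE !mxadj0.
by rewrite mulmx_block !mulmx0 !mul0mx !addr0 !add0r pp qq.
Qed.

Lemma mvn_refl n (p : 'M[B]_n) : mx_projection p -> mvn p p.
Proof. by move=> [pp pE]; exists p; rewrite pE. Qed.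

Lemma mvn_sym m n (p : 'M[B]_m) (q : 'M[B]_n) : mvn p q -> mvn q p.
Proof. by move=> [v [vp vq]]; exists (mxadj v); rewrite mxadjK. Qed.

Lemma mvn_trans m n k (p : 'M[B]_m) (q : 'M[B]_n) (r : 'M[B]_k) :
  mx_projection p -> mx_projection r -> mvn p q -> mvn q r -> mvn p r.
Proof.
move=> [pp _] [rr _] [v [vp vq]] [w [wq wr]]; exists (w *m v).
rewrite mxadjM; split.
  by rewrite mulmxA -(mulmxA _ _ w) wq -vq mulmxA vp -mulmxA vp.
by rewrite mulmxA -(mulmxA w) vq -wq mulmxA wr -mulmxA wr.
Qed.

Lemma mvn_dsum m n m' n' (p : 'M[B]_m) (q : 'M[B]_n)
    (p' : 'M[B]_m') (q' : 'M[B]_n') :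
  mvn p p' -> mvn q q' -> mvn (dsum p q) (dsum p' q').
Proof.
move=> [v [vp vp']] [w [wq wq']]; exists (block_mx v 0 0 w).
rewrite mxadj_block !mxadj0 !mulmx_block !mulmx0 !mul0mx !addr0 !add0r.
by rewrite vp vp' wq wq'.
Qed.

Lemma mvn_dsumC m n (p : 'M[B]_m) (q : 'M[B]_n) :
  mx_projection p -> mx_projection q -> mvn (dsum p q) (dsum q p).
Proof.
move=> [pp pE] [qq qE]; exists (block_mx 0 q p 0).
rewrite mxadj_block !mxadj0 pE qE !mulmx_block.
by rewrite !mulmx0 !mul0mx !addr0 !add0r pp qq.
Qed.

Lemma mvn_cast m n (e : m = n) (p : 'M[B]_m) :
  mx_projection p -> mvn p (castmx (e, e) p).
Proof. by case: n / e => pP; rewrite castmx_id; exact: mvn_refl. Qed.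

Lemma mvn_dsumA m n k (p : 'M[B]_m) (q : 'M[B]_n) (r : 'M[B]_k) :
  mx_projection p -> mx_projection q -> mx_projection r ->
  mvn (dsum p (dsum q r)) (dsum (dsum p q) r).
Proof.
move=> pP qP rP; apply: mvn_sym.
have -> : dsum p (dsum q r) =
    castmx (esym (addnA m n k), esym (addnA m n k)) (dsum (dsum p q) r).
  by rewrite /dsum -(row_mx0 B m n k) -(col_mx0 B n k m) block_mxA
    row_mx0 col_mx0.
by apply: mvn_cast; apply: mx_projection_dsum => //; exact: mx_projection_dsum.
Qed.

Lemma mx_projection0 n : mx_projection (0 : 'M[B]_n).
Proof. by split; rewrite ?mulmx0 ?mxadj0. Qed.

Lemma mvn_dsum0 m n (p : 'M[B]_n) :
  mx_projection p -> mvn (dsum (0 : 'M[B]_m) p) p.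
Proof.
move=> [pp pE]; apply: mvn_sym; exists (col_mx 0 p).
rewrite mxadj_col mxadj0 pE mul_row_col mul_col_row.
by rewrite !mulmx0 !mul0mx add0r pp.
Qed.

End Adjoint.

Record projection (B : starRingType) := Projection {
  proj_size : nat;
  proj_mx :> 'M[B]_proj_size;
  projP : mx_projection proj_mx
}.

HB.instance Definition _ (B : starRingType) := gen_eqMixin (projection B).
HB.instance Definition _ (B : starRingType) := gen_choiceMixin (projection B).

Section MvnMonoid.
Variable B : starRingType.
Implicit Types p q : projection B.

Definition mvnb p q : bool := `[< mvn p q >].

Fact mvnb_equiv : equiv_class_of mvnb.
Proof.
split.
- by move=> p; apply/asboolP; apply: mvn_refl; exact: projP.
- by move=> p q; apply/asboolP/asboolP; exact: mvn_sym.
- move=> q p r /asboolP pq /asboolP qr; apply/asboolP.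
  by apply: mvn_trans pq qr; exact: projP.
Qed.

Canonical mvn_equiv := EquivRelPack mvnb_equiv.

Definition mvn_monoid : Type := {eq_quot mvn_equiv}.
HB.instance Definition _ := Choice.on mvn_monoid.
HB.instance Definition _ := Quotient.on mvn_monoid.

Definition mvn_class p : mvn_monoid := \pi_mvn_monoid p.

Lemma mvn_classP p q : mvn_class p = mvn_class q <-> mvn p q.
Proof.
split=> [/eqmodP/asboolP //|pq]; by apply/eqmodP/asboolP.
Qed.

Lemma mvn_class_repr (x : mvn_monoid) : mvn_class (repr x) = x.
Proof. exact: reprK. Qed.

Definition proj_dsum p q : projection B :=
  Projection (mx_projection_dsum (projP p) (projP q)).

Definition mvn_add (x y : mvn_monoid) : mvn_monoid :=
  mvn_class (proj_dsum (repr x) (repr y)).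
Definition mvn_zero : mvn_monoid :=
  mvn_class (Projection (mx_projection0 B 0)).

Lemma mvn_classD p q :
  mvn_class (proj_dsum p q) = mvn_add (mvn_class p) (mvn_class q).
Proof.
by apply/mvn_classP/mvn_dsum; apply/mvn_classP; rewrite mvn_class_repr.
Qed.

Fact mvn_addA : associative mvn_add.
Proof.
move=> x y z; rewrite -[x]mvn_class_repr -[y]mvn_class_repr.
rewrite -[z]mvn_class_repr -!mvn_classD; apply/mvn_classP.
by apply: mvn_dsumA; exact: projP.
Qed.

Fact mvn_addC : commutative mvn_add.
Proof.
move=> x y; rewrite -[x]mvn_class_repr -[y]mvn_class_repr -!mvn_classD.
by apply/mvn_classP/mvn_dsumC; exact: projP.
Qed.

Fact mvn_add0 : left_id mvn_zero mvn_add.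
Proof.
move=> x; rewrite -[x]mvn_class_repr -!mvn_classD.
by apply/mvn_classP/mvn_dsum0; exact: projP.
Qed.

HB.instance Definition _ :=
  GRing.isNmodule.Build mvn_monoid mvn_addA mvn_addC mvn_add0.

End MvnMonoid.

Section MvnMap.
Variables (B C : starRingType) (f : starMorphism B C).

Lemma map_mx_adj m n (M : 'M[B]_(m, n)) :
  map_mx f (mxadj M) = mxadj (map_mx f M).
Proof. by apply/matrixP => i j; rewrite !mxE map_star. Qed.

Lemma map_mx_projection n (p : 'M[B]_n) :
  mx_projection p -> mx_projection (map_mx f p).
Proof. by move=> [pp pE]; split; rewrite -?map_mxM ?pp // -map_mx_adj pE. Qed.

Definition proj_map (p : projection B) : projection C :=
  Projection (map_mx_projection (projP p)).

Definition mvn_map (x : mvn_monoid B) : mvn_monoid C :=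
  mvn_class (proj_map (repr x)).

Lemma mvn_map_class p : mvn_map (mvn_class p) = mvn_class (proj_map p).
Proof.
apply/mvn_classP.
have /mvn_classP [v [vp vq]] := mvn_class_repr (mvn_class p).
by exists (map_mx f v); rewrite -map_mx_adj -!map_mxM vp vq.
Qed.

Fact mvn_map_nmod : nmod_morphism mvn_map.
Proof.
split.
  rewrite [0 in LHS]/(mvn_zero B) mvn_map_class; apply/mvn_classP.
  by exists 0; split; apply/matrixP => -[].
move=> x y; rewrite -[x]mvn_class_repr -[y]mvn_class_repr.
rewrite -[_ + _ in LHS]mvn_classD !mvn_map_class -[RHS]mvn_classD.
apply/mvn_classP; rewrite /= /dsum map_block_mx !map_mx0.
by apply: mvn_refl; apply: mx_projection_dsum; apply: map_mx_projection;
  exact: projP.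
Qed.

HB.instance Definition _ :=
  GRing.isNmodMorphism.Build (mvn_monoid B) (mvn_monoid C) mvn_map mvn_map_nmod.

End MvnMap.

Section Grothendieck.
Variable M : nmodType.
Implicit Types u v w : (M * M)%type.

Definition groth_rel u v : bool :=
  `[< exists z, u.1 + v.2 + z = v.1 + u.2 + z >].

Fact groth_equiv_class : equiv_class_of groth_rel.
Proof.
split.
- by move=> u; apply/asboolP; exists 0.
- by move=> u v; apply/asboolP/asboolP => -[z uv]; exists z.
- move=> v u w /asboolP[z uv] /asboolP[z' vw]; apply/asboolP.
  exists (v.1 + v.2 + (z + z')).
  rewrite [LHS](AC (2*(2*2)) ((1*4*5)*(3*2*6))). rewrite /= uv vw.
  by rewrite [RHS](AC (2*(2*2)) ((3*2*5)*(1*4*6))).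
Qed.

Canonical groth_equiv := EquivRelPack groth_equiv_class.

Definition groth : Type := {eq_quot groth_equiv}.
HB.instance Definition _ := Choice.on groth.
HB.instance Definition _ := Quotient.on groth.

Definition groth_class (x y : M) : groth := \pi_groth (x, y).

Lemma groth_classP x y x' y' :
  groth_class x y = groth_class x' y' <->
  exists z, x + y' + z = x' + y + z.
Proof.
by split=> [/eqmodP/asboolP //|xy]; apply/eqmodP/asboolP.
Qed.

Lemma groth_class_repr (g : groth) : groth_class (repr g).1 (repr g).2 = g.
Proof. by rewrite /groth_class -surjective_pairing; exact: reprK. Qed.

Definition groth_add (g h : groth) : groth :=
  groth_class ((repr g).1 + (repr h).1) ((repr g).2 + (repr h).2).
Definition groth_opp (g : groth) : groth := groth_class (repr g).2 (repr g).1.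
Definition groth_zero : groth := groth_class 0 0.

Lemma groth_classD x y x' y' :
  groth_add (groth_class x y) (groth_class x' y') =
  groth_class (x + x') (y + y').
Proof.
apply/groth_classP.
have /groth_classP[z zE] := groth_class_repr (groth_class x y).
have /groth_classP[z' zE'] := groth_class_repr (groth_class x' y').
exists (z + z').
rewrite [LHS](AC (2*2*2) ((1*3*5)*(2*4*6))) /= zE zE'.
by rewrite [RHS](AC (2*2*2) ((1*3*5)*(2*4*6))).
Qed.

Lemma groth_classN x y : groth_opp (groth_class x y) = groth_class y x.
Proof.
apply/groth_classP.
have /groth_classP[z zE] := groth_class_repr (groth_class x y).
by exists z; rewrite (addrC _ x) (addrC y) zE.
Qed.

Fact groth_addA : associative groth_add.
Proof.
move=> g h k; rewrite -[g]groth_class_repr -[h]groth_class_repr.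
by rewrite -[k]groth_class_repr !groth_classD !addrA.
Qed.

Fact groth_addC : commutative groth_add.
Proof.
move=> g h; rewrite -[g]groth_class_repr -[h]groth_class_repr !groth_classD.
by congr groth_class; exact: addrC.
Qed.

Fact groth_add0 : left_id groth_zero groth_add.
Proof. by move=> g; rewrite -[g]groth_class_repr groth_classD !add0r. Qed.

Fact groth_addN : left_inverse groth_zero groth_opp groth_add.
Proof.
move=> g; rewrite -[g]groth_class_repr groth_classN groth_classD.
by apply/groth_classP; exists 0; rewrite !addr0 !add0r addrC.
Qed.

HB.instance Definition _ :=
  GRing.isZmodule.Build groth groth_addA groth_addC groth_add0 groth_addN.

End Grothendieck.

Section GrothendieckMap.
Variables (M N : nmodType) (f : {additive M -> N}).

Definition groth_map (g : groth M) : groth N :=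
  groth_class (f (repr g).1) (f (repr g).2).

Lemma groth_map_class x y :
  groth_map (groth_class x y) = groth_class (f x) (f y).
Proof.
apply/groth_classP.
have /groth_classP[z zE] := groth_class_repr (groth_class x y).
by exists (f z); rewrite -!raddfD zE.
Qed.

Fact groth_map_zmod : zmod_morphism groth_map.
Proof.
move=> g h; rewrite -[g]groth_class_repr -[h]groth_class_repr.
rewrite [X in groth_map (_ + X)]groth_classN [X in groth_map X]groth_classD.
rewrite !groth_map_class [X in _ = _ + X]groth_classN [RHS]groth_classD.
by rewrite !raddfD.
Qed.

HB.instance Definition _ :=
  GRing.isZmodMorphism.Build (groth M) (groth N) groth_map groth_map_zmod.

End GrothendieckMap.

Definition K00 (B : starRingType) : zmodType := groth (mvn_monoid B).

Definition K00_class (B : starRingType) (p : projection B) : K00 B :=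
  groth_class (mvn_class p) 0.

Definition K00_map (B C : starRingType) (f : starMorphism B C) :
  K00 B -> K00 C := groth_map (mvn_map f).

Section KTheory.
Variables (R : realType) (A : cstarAlgType R).

(* K_0(A) is the kernel of the map K_00(A~) -> K_00(C) induced by the
   quotient map A~ -> A~/A = C. *)
Definition K0 : set (K00 (unitization A)) :=
  [set g | K00_map (@scalar_part R A) g = 0].

Fact uinj_projection (p : A) :
  is_projection p -> mx_projection (\matrix_(i < 1, j < 1) uinj p).
Proof.
move=> [pp pE]; split; apply/matrixP => i j; rewrite !mxE.
  rewrite big_ord1 !mxE; congr pair; first exact: mulr0.
  by rewrite /= !scale0r !add0r.
by congr pair; [exact: conjC0|].
Qed.

Definition K0_class (p : A) (pP : is_projection p) : K00 (unitization A) :=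
  K00_class (Projection (uinj_projection pP)).

Lemma K0_class_in (p : A) (pP : is_projection p) : K0 (K0_class pP).
Proof.
rewrite /K0 /= /K00_map /K0_class /K00_class groth_map_class raddf0.
apply/groth_classP; exists 0; rewrite /= mvn_map_class !addr0.
apply/mvn_classP; exists 0; split; apply/matrixP => i j; last by case: i.
by rewrite !mxE big_ord0.
Qed.

Definition stably_finite : Prop :=
  forall (r : nat) (v : 'M[unitization A]_r), (1 <= r)%N ->
    v *m mxadj v = 1%:M -> mxadj v *m v = 1%:M.

End KTheory.

Arguments K0 {R} A.

(* Main.v *)
(* If pi0(q) and pi0(bar q) were both compact, say pi0(q) = pi0(j) and
   pi0(bar q) = pi0(k) with j, k in J0, then (q - j)(q - bar k) would lie in
   P0 /\ bar P0 = 0, hence q = q q in J0 + bar J0. So some projection q of A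
   has pi0(q) noncompact, hence of infinite rank. Lifting rank-one operators
   through J0 ~ K(H0) gives a minimal projection p in J0 and, for every N, a
   subprojection of q equivalent to a sum of N copies of p. Since [q] = n [p]
   in K_0(A), taking N > n yields [p (+) ... (+) p (+) f] = 0 in K_00 for some
   projection f, with N - n >= 1 copies of p. In a stably finite ring a
   projection s with [s] = 0 vanishes, because s (+) r ~ r makes s (+) r
   equivalent to its own subprojection 0 (+) r; so p = 0, a contradiction. *)
Require Import Defs.
From HB Require Import structures.
From mathcomp Require Import all_boot all_order all_algebra.
From mathcomp Require Import complex.
From mathcomp Require Import boolp classical_sets functions cardinality reals.
From mathcomp Require Import topology normedtype.

Set Implicit Arguments.
Unset Strict Implicit.
Unset Printing Implicit Defensive.

Import Order.TTheory GRing.Theory Num.Theory numFieldNormedType.Exports.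

Local Open Scope classical_set_scope.
Local Open Scope ring_scope.

(** * Projections and $K_{00}$ over a stably finite star ring *)

Section StablyFinite.
Variable B : starRingType.

(** Stated for an arbitrary star ring; at [unitization A] it unfolds to the same proposition as
    [stably_finite A]. *)
Definition stably_finite_ring : Prop :=
  forall (r : nat) (v : 'M[B]_r), (1 <= r)%N ->
    v *m mxadj v = 1%:M -> mxadj v *m v = 1%:M.

(** The axioms of a star ring do not postulate [star 1 = 1]. It follows because [star 1] is a left
    unit, by applying [star] to [star b * 1]. *)
Lemma mxadj1 n : mxadj (1%:M : 'M[B]_n) = 1%:M.
Proof.
have sM (b : B) : star 1 * b = b by rewrite -[b in LHS]starK -starM mulr1 starK.
apply/matrixP => i j; rewrite !mxE eq_sym.
by case: eqP => _ /=; rewrite ?mulr1n ?mulr0n ?star0 // -[LHS]mulr1 sM.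
Qed.

Lemma mxadjD m n (a b : 'M[B]_(m, n)) : mxadj (a + b) = mxadj a + mxadj b.
Proof. by apply/matrixP => i j; rewrite !mxE starD. Qed.

Lemma mxadjN m n (a : 'M[B]_(m, n)) : mxadj (- a) = - mxadj a.
Proof. by apply: (addrI (mxadj a)); rewrite -mxadjD !subrr mxadj0. Qed.

Lemma mx_projectionB n (P E : 'M[B]_n) :
  mx_projection P -> mx_projection E -> P *m E = E -> mx_projection (P - E).
Proof.
move=> [PP PE] [EE Ea] PleE.
have EP : E *m P = E by rewrite -Ea -{1}PE -mxadjM PleE.
split; last by rewrite mxadjD mxadjN PE Ea.
by rewrite mulmxBl !mulmxBr PP PleE EP EE subrr subr0.
Qed.

(* A partial isometry from P to E <= P plus 1 - P is an isometry, hence unitary,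
   so that E + (1 - P) = 1. *)
Lemma mvn_sub_eq n (P E : 'M[B]_n) :
    (forall v : 'M[B]_n, v *m mxadj v = 1%:M -> mxadj v *m v = 1%:M) ->
    mx_projection P -> mx_projection E -> P *m E = E -> mvn P E ->
  E = P.
Proof.
move=> fin [PP PE] [EE _] PleE [w [wP wE]].
pose W := E *m w; pose D := 1%:M - P.
have WE : W = w *m P by rewrite /W -wP -wE mulmxA.
have PW : P *m W = W by rewrite mulmxA PleE.
have DE : mxadj D = D by rewrite mxadjD mxadjN mxadj1 PE.
have PD : P *m D = 0 by rewrite mulmxBr mulmx1 PP subrr.
have DP : D *m P = 0 by rewrite mulmxBl mul1mx PP subrr.
have DD : D *m D = D by rewrite {1}/D mulmxBl mul1mx PD subr0.
have WW : mxadj W *m W = P.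
  by rewrite WE mxadjM PE mulmxA -(mulmxA P) wP PP PP.
have WWa : W *m mxadj W = E.
  by rewrite {2}WE mxadjM PE mulmxA {1}WE -(mulmxA w) PP -WE -mulmxA wE EE.
have WD : W *m D = 0 by rewrite WE -mulmxA PD mulmx0.
have DW : D *m W = 0 by rewrite -PW mulmxA DP mul0mx.
have aDW : mxadj W *m D = 0 by rewrite -DE -mxadjM DW mxadj0.
have DaW : D *m mxadj W = 0 by rewrite -{1}DE -mxadjM WD mxadj0.
have P_D : P + D = 1%:M by rewrite addrC subrK.
clearbody D W; have := fin (mxadj (W + D)); rewrite mxadjK mxadjD DE => h.
have {h} : (W + D) *m (mxadj W + D) = 1%:M.
  by apply: h; rewrite mulmxDl !mulmxDr WW aDW DW DD addr0 add0r.
rewrite mulmxDl !mulmxDr WWa WD DaW DD addr0 add0r -P_D.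
by move/addIr.
Qed.

Lemma K00_classD (p q : projection B) :
  K00_class (proj_dsum p q) = K00_class p + K00_class q.
Proof.
rewrite /K00_class [RHS]groth_classD addr0.
by congr groth_class; exact: mvn_classD.
Qed.

Lemma eq_K00_class (p q : projection B) : mvn p q -> K00_class p = K00_class q.
Proof. by move=> pq; congr groth_class; apply/mvn_classP. Qed.

Lemma K00_class_eq0 n (s : 'M[B]_n) (sP : mx_projection s) :
  stably_finite_ring -> K00_class (Projection sP) = 0 -> s = 0.
Proof.
(* Stable finiteness speaks of sizes at least 1 only, so size 0 is treated apart, where all matrices
   coincide. *)
move=> fin; case: n s sP => [|k] s sP; first by move=> _; apply/matrixP => -[].
move=> /groth_classP[z]; rewrite !addr0 add0r -[z]mvn_class_repr.
set r := repr z; rewrite -[X in X = _ -> _]mvn_classD => /mvn_classP/= sr.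
have rP : mx_projection r by exact: projP.
have : dsum 0 r = dsum s r.
  apply: mvn_sub_eq => [v|||/=|/=]; first exact: fin.
  - exact: mx_projection_dsum.
  - exact: mx_projection_dsum (mx_projection0 _ _) _.
  - rewrite mulmx_block !mulmx0 !mul0mx !addr0 !add0r.
    by rewrite (proj1 rP).
  - apply: (mvn_trans _ _ sr); first exact: mx_projection_dsum.
      exact: mx_projection_dsum (mx_projection0 _ _) _.
    by apply: mvn_sym; apply: mvn_dsum0.
by move=> /eq_block_mx[].
Qed.

Lemma scalar_projection n (p : B) :
  p * p = p -> star p = p -> mx_projection (p%:M : 'M[B]_n).
Proof.
move=> pp pE; split; first by rewrite -scalar_mxM pp.
apply/matrixP => i j; rewrite !mxE eq_sym.
by case: eqP => _; rewrite /= ?mulr1n ?mulr0n ?pE ?star0.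
Qed.

Lemma K00_class0 (s : projection B) : proj_size s = 0 -> K00_class s = 0.
Proof.
case: s => n s sP /= n0; subst n; congr groth_class; apply/mvn_classP.
by exists 0; split; apply/matrixP => -[].
Qed.

Lemma K00_class_sub n (P E : 'M[B]_n) (PP : mx_projection P)
    (EP : mx_projection E) (DP : mx_projection (P - E)) :
  P *m E = E ->
  K00_class (Projection PP) =
    K00_class (Projection EP) + K00_class (Projection DP).
Proof.
move=> PleE; rewrite -K00_classD; apply: eq_K00_class => /=.
have EleP : E *m P = E by rewrite -(proj2 EP) -{1}(proj2 PP) -mxadjM PleE.
(* The column is a partial isometry from [P] to the direct sum: its diagonal products add up to [P],
   and its cross products vanish because [E] and [P - E] are orthogonal. *)
exists (col_mx E (P - E)).
rewrite mxadj_col (proj2 EP) (proj2 DP) mul_row_col mul_col_row.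
rewrite (proj1 EP) (proj1 DP) addrC subrK; split=> //.
by rewrite mulmxBr mulmxBl EleP PleE (proj1 EP) subrr.
Qed.

Lemma K00_class_scalar (p : B) (pp : p * p = p) (pE : star p = p) n :
  K00_class (Projection (scalar_projection n pp pE)) =
    K00_class (Projection (scalar_projection 1 pp pE)) *+ n.
Proof.
elim: n => [|n IHn]; first exact: K00_class0.
rewrite mulrS -IHn -K00_classD; apply: eq_K00_class => /=.
rewrite /dsum -(scalar_mx_block 1 n p); apply: mvn_refl.
exact: scalar_projection.
Qed.

(** [V] embeds [N] copies of [p] below [Q]. Cancelling [n] of them in $K_{00}$ leaves a vanishing
    class with at least one copy of [p] as a direct summand. *)
Lemma mvn_infinite_rank_eq0 (p : B) (pp : p * p = p) (pE : star p = p)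
    k N (Q : 'M[B]_k) (QP : mx_projection Q) (V : 'M[B]_(k, N)) (n : int) :
    stably_finite_ring -> Q *m V = V -> mxadj V *m V = p%:M -> n < N ->
    K00_class (Projection QP) =
      K00_class (Projection (scalar_projection 1 pp pE)) *~ n ->
  p = 0.
Proof.
move=> fin QV VV nN Qn.
have pP := scalar_projection N pp pE.
(* The middle factor [p%:M] makes idempotence follow from [VV] alone; a star ring carries no norm
   from which [V *m p%:M = V] could be derived. *)
have EP : mx_projection (V *m p%:M *m mxadj V).
  split; last by rewrite !mxadjM mxadjK (proj2 pP) mulmxA.
  rewrite !mulmxA -(mulmxA _ (mxadj V) V) VV.
  by rewrite -(mulmxA V) (proj1 pP) -(mulmxA V) (proj1 pP).
have QE : Q *m (V *m p%:M *m mxadj V) = V *m p%:M *m mxadj V.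
  by rewrite !mulmxA QV.
have DP := mx_projectionB QP EP QE.
have pV : mvn (p%:M : 'M_N) (V *m p%:M *m mxadj V).
  exists (V *m p%:M); rewrite mxadjM (proj2 pP); split.
    by rewrite mulmxA -(mulmxA p%:M) VV !(proj1 pP).
  by rewrite !mulmxA -(mulmxA V) (proj1 pP).
move: Qn; rewrite (K00_class_sub QP EP DP QE).
rewrite -(@eq_K00_class (Projection (scalar_projection N pp pE))
  (Projection EP) pV).
rewrite K00_class_scalar => /eqP; rewrite -subr_eq0 addrAC pmulrn -mulrzBr.
(* The integer [n] may be negative, but the difference is positive; the form [m.+1] guarantees a
   diagonal entry [p] to read off. *)
have [m ->] : exists m : nat, N%:Z - n = m.+1.
  case: (N%:Z - n) (subr_gt0 n N%:Z) => [[|m]|m] //; rewrite ?nN //.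
  by exists m.
rewrite -pmulrn -K00_class_scalar -K00_classD => /eqP.
move=> /(K00_class_eq0 fin)/(congr1 ulsubmx); rewrite /= /dsum block_mxKul.
by move=> /matrixP/(_ 0 0); rewrite !mxE eqxx mulr1n => ->.
Qed.

End StablyFinite.

(** * Rank-one and compact operators on a Hilbert space *)

Section RankOne.
Variables (R : realType) (H : hilbertType R).
Implicit Types x y u z : H.

(* [R[i]] carries its topology only through the alias [R[i]^o]. *)
Lemma continuous_real_complex : continuous (fun r : R => r%:C%C : R[i]^o).
Proof.
move=> x; apply/cvgrPdist_lt => e e0.
have eE : e = (complex.Re e)%:C%C by rewrite RRe_real// gtr0_real.
have Re0 : 0 < complex.Re e by rewrite -ltcR -eE.
near=> y; rewrite -rmorphB /= normc_def /= expr0n addr0 sqrtr_sqr eE ltcR.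
by near: y; exact: cvgr_dist_lt.
Unshelve. all: by end_near. Qed.

(** The disc lies in the image of the compact real square $[-1,1]^2$ under the continuous map
    $(a,b)\mapsto a+ib$. *)
Lemma disc_precompact : precompact [set c : R[i]^o | `|c| <= 1].
Proof.
pose f (r : R * R) : R[i]^o := r.1%:C%C + 'i%C * r.2%:C%C.
have cf : continuous f.
  move=> r; apply: cvgD; last apply: cvgM; first 2 last.
  - by apply: cvg_comp; [exact: cvg_snd|exact: continuous_real_complex].
  - by apply: cvg_comp; [exact: cvg_fst|exact: continuous_real_complex].
  - exact: cvg_cst.
have cK : compact (f @` (`[-1, 1]%classic `*` `[-1, 1]%classic)).
  apply: continuous_compact; first exact: continuous_subspaceT.
  by apply: compact_setX; exact: segment_compact.
apply: (@precompact_subset _ _ (f @` (`[-1, 1]%classic `*` `[-1, 1]%classic))).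
  move=> c /= c1; exists (complex.Re c, complex.Im c); last first.
    by rewrite /f /= -complexE.
  have c1' : (complex.Re c) ^+ 2 + (complex.Im c) ^+ 2 <= 1.
    by rewrite -lecR add_Re2_Im2 /= expr_le1.
  have sq (r : R) : r ^+ 2 <= 1 -> r \in `[-1, 1].
    move=> r1; rewrite in_itv /= -ler_norml -(@expr_le1 _ 2) ?normr_ge0 //.
    by rewrite real_normK // num_real.
  by split=> /=; apply: sq; apply: le_trans c1'; rewrite ?lerDl ?lerDr sqr_ge0.
rewrite precompact_closed //; apply: compact_closed cK; exact: norm_hausdorff.
Qed.

(** The image of the unit ball lies in $K+L$, the image of the compact set $K\times L$ under
    addition. *)
Lemma compact_operatorD (S T : H -> H) :
  compact_operator H S -> compact_operator H T ->
  compact_operator H (fun x => S x + T x).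
Proof.
move=> [[Sl Sc] [K SK [cK _]]] [[Tl Tc] [L TL [cL _]]].
split.
  split=> [a x y|x]; first by rewrite Sl Tl scalerDr addrACA.
  by apply: cvgD; [exact: Sc|exact: Tc].
have cKL : compact ((fun z : H * H => z.1 + z.2) @` (K `*` L)).
  apply: continuous_compact; last exact: compact_setX.
  by apply: continuous_subspaceT => z; exact: add_continuous.
exists ((fun z : H * H => z.1 + z.2) @` (K `*` L)); last first.
  by split=> //; apply: compact_closed cKL; exact: norm_hausdorff.
move=> _ [x x1 <-]; exists (S x, T x) => //.
by split; [apply: SK; exists x|apply: TL; exists x].
Qed.

Lemma compact_operator0 : compact_operator H (fun=> 0).
Proof.
split; first split.
- by move=> a x y; rewrite scaler0 addr0.
- by move=> x; exact: cvg_cst.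
- exists [set 0]; first by move=> _ [x _ <-].
  split; first exact: compact_set1.
  by apply: compact_closed; [exact: norm_hausdorff|exact: compact_set1].
Qed.

(** The operator $x\otimes u^*$; the form [hdot] is linear in its first argument and
    conjugate-linear in its second. *)
Definition rank_one x u : H -> H := fun z => hdot z u *: x.

Lemma hdotC x y : hdot x y = (hdot y x)^*.
Proof. by rewrite hermC expr0 mul1r. Qed.

Lemma hdot_ge0 x : 0 <= hdot x x.
Proof. by rewrite -hdotE exprn_ge0. Qed.

Lemma hdot_eq0 x : (hdot x x == 0) = (x == 0).
Proof. by rewrite -hdotE expf_eq0 normr_eq0. Qed.

Lemma hdotZZ (c : R[i]) x : hdot (c *: x) (c *: x) = `|c| ^+ 2 * hdot x x.
Proof. by rewrite linearZl_LR linearZr_LR /= mulrA normCK. Qed.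

(** Cauchy-Schwarz against a unit vector, by Pythagoras for $z=cu+w$ with $w\perp u$. *)
Lemma norm_hdot_unit z u : hdot u u = 1 -> `|hdot z u| <= `|z|.
Proof.
move=> u1; set c := hdot z u.
set w := z - c *: u.
have wu : hdot w u = 0 by rewrite linearBl linearZl_LR /= u1 mulr1 subrr.
have uw : hdot (c *: u) w = 0.
  by rewrite hdotC linearZr_LR /= wu mulr0 conjC0.
rewrite -(@ler_pXn2r _ 2) ?nnegrE ?normr_ge0 // hdotE.
have -> : z = c *: u + w by rewrite addrC subrK.
have -> : hdot (c *: u + w) (c *: u + w) = hdot (c *: u) (c *: u) + hdot w w.
  exact: hnormDd.
by rewrite hdotZZ u1 mulr1 lerDl hdot_ge0.
Qed.

(** By Cauchy-Schwarz the unit ball is sent into the multiples of [x] by scalars of the unit disc,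
    which is precompact. *)
Lemma compact_rank_one x u : hdot u u = 1 -> compact_operator H (rank_one x u).
Proof.
move=> u1.
have lT : linear (rank_one x u).
  by move=> a y z; rewrite /rank_one linearDl linearZl_LR scalerDl scalerA.
pose T : {linear H -> H} := HB.pack (rank_one x u)
  (GRing.isLinear.Build _ _ _ _ _ lT).
split; first split=> //.
  apply: (@bounded_linear_continuous _ _ _ T).
  apply/ex_bound; exists `|x|; apply/nbhs_norm0P; exists 1 => //= z /= z1.
  rewrite normrZ ler_piMl // (le_trans (norm_hdot_unit _ u1)) //.
  exact: ltW.
have [K DK [cK _]] := disc_precompact.
have cKx : compact ((fun c : R[i]^o => c *: x) @` K).
  apply: continuous_compact cK; apply: continuous_subspaceT.
  exact: scalel_continuous.
exists ((fun c : R[i]^o => c *: x) @` K); last first.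
  by split=> //; apply: compact_closed cKx; exact: norm_hausdorff.
move=> _ [z z1 <-]; exists (hdot z u) => //; apply: DK.
exact: le_trans (norm_hdot_unit _ u1) z1.
Qed.

Lemma compact_rank_one_sum n (x : 'I_n -> H) :
  (forall i, hdot (x i) (x i) = 1) ->
  compact_operator H (fun z => \sum_i rank_one (x i) (x i) z).
Proof.
elim: n x => [|n IHn] x x1.
  rewrite (_ : (fun _ => _) = fun=> 0); first exact: compact_operator0.
  by apply/funext => z; rewrite big_ord0.
rewrite (_ : (fun _ => _) = fun z => rank_one (x ord0) (x ord0) z +
    \sum_i rank_one (x (lift ord0 i)) (x (lift ord0 i)) z).
  by apply: compact_operatorD; [exact: compact_rank_one|exact: IHn].
by apply/funext => z; rewrite big_ord_recl.
Qed.

(** Gram-Schmidt inside the range of [Q]: a finite orthonormal family cannot exhaust it, since [Q]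
    would then be a finite sum of rank-one operators, hence compact. *)
Lemma noncompact_projection_orthonormal (Q : H -> H) :
    linear Q -> Q \o Q = Q -> (forall x y, hdot (Q x) y = hdot x (Q y)) ->
    ~ compact_operator H Q -> forall n,
  exists x : 'I_n -> H,
    (forall i, Q (x i) = x i) /\ (forall i j, hdot (x i) (x j) = (i == j)%:R).
Proof.
move=> Ql QQ Qsym Qnc; elim=> [|n [x [Qx xx]]].
  by exists (fun=> 0); split=> -[].
have [z zP] : exists z, Q z <> \sum_i rank_one (x i) (x i) z.
  apply/existsNP => QE; apply: Qnc.
  rewrite (_ : Q = fun z => \sum_i rank_one (x i) (x i) z); last exact/funext.
  by apply: compact_rank_one_sum => i; rewrite xx eqxx.
pose QL : {linear H -> H} := HB.pack Q (GRing.isLinear.Build _ _ _ _ _ Ql).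
(* The residue of [Q z] after removing its components along the [x i]: these are $\langle
   Qz,x_i\rangle=\langle z,Qx_i\rangle=\langle z,x_i\rangle$. *)
pose y := Q z - \sum_i rank_one (x i) (x i) z.
have Qy : Q y = y.
  rewrite /y -[Q]/(QL : H -> H) linearB linear_sum /=.
  rewrite -[Q (Q z)]/((Q \o Q) z) QQ; congr (_ - _); apply: eq_bigr => i _.
  by rewrite -[Q]/(QL : H -> H) linearZ /= Qx.
have y_neq0 : y != 0 by rewrite subr_eq0; apply/eqP.
have yx i : hdot y (x i) = 0.
  rewrite linearBl /= Qsym Qx linear_sumlz /= (bigD1 i) //= big1 => [|j ji].
    by rewrite addr0 linearZl_LR /= xx eqxx mulr1 subrr.
  by rewrite linearZl_LR /= xx (negPf ji) mulr0.
have xy i : hdot (x i) y = 0 by rewrite hdotC yx conjC0.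
pose c := (sqrtC (hdot y y))^-1.
have cyy : hdot (c *: y) (c *: y) = 1.
  rewrite hdotZZ normfV ger0_norm ?sqrtC_ge0 ?hdot_ge0 // exprVn sqrtCK.
  by rewrite mulVf // hdot_eq0.
exists (fun i => if unlift ord0 i is Some j then x j else c *: y); split.
  move=> i; case: (unliftP ord0 i) => [j _|_] //.
  by rewrite -[Q]/(QL : H -> H) linearZ /= Qy.
move=> i j; case: (unliftP ord0 i) => [i' ->|->];
  case: (unliftP ord0 j) => [j' ->|->]; rewrite /= ?eqxx //.
- by rewrite linearZr_LR /= xy mulr0.
- by rewrite linearZl_LR /= yx mulr0.
Qed.

End RankOne.

(** * Lifting operators through $\mathcal{J}_0\cong\mathcal{K}(\mathcal{H}_0)$ *)

Section Lifting.
Variables (R : realType) (A : cstarAlgType R) (H0 : hilbertType R).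
Variables (pi0 : A -> H0 -> H0) (J0 : set A).
Hypothesis pi0_rep : star_representation pi0.
Hypothesis J0_ideal : closed_ideal J0.
Hypothesis J0_iso : set_bij J0 (compact_operator H0) pi0.

Let J0l a b : J0 b -> J0 (cmul a b).
Proof. by move=> /((proj2 J0_ideal) a)[]. Qed.

Let J0r a b : J0 b -> J0 (cmul b a).
Proof. by move=> /((proj2 J0_ideal) a)[]. Qed.

Let J0_0 : J0 0.
Proof. by case: J0_ideal => -[]. Qed.

Let J0D a b : J0 a -> J0 b -> J0 (a + b).
Proof.
by case: J0_ideal => -[_ _ h] _ aJ bJ; have := h 1 a b aJ bJ; rewrite scale1r.
Qed.

Let J0N a : J0 a -> J0 (- a).
Proof.
case: J0_ideal => -[_ J00 h] _ aJ.
by have := h (- 1) a 0 aJ J00; rewrite scaleN1r addr0.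
Qed.

Let pi0_inj a b : J0 a -> J0 b -> pi0 a = pi0 b -> a = b.
Proof. by case: J0_iso => _ inj _ aJ bJ; apply: inj; rewrite inE. Qed.

Let pi0_lift T : compact_operator H0 T -> exists2 a, J0 a & pi0 a = T.
Proof. by case: J0_iso => _ _ sur /sur[a aJ <-]; exists a. Qed.

Let pi0M a b x : pi0 (cmul a b) x = pi0 a (pi0 b x).
Proof. by rewrite (repM pi0_rep). Qed.

Let pi0B a b : pi0 (a - b) = pi0 a - pi0 b.
Proof.
by rewrite addrC -[- b]scaleN1r (rep_linear pi0_rep) scaleN1r addrC.
Qed.

Let pi0_0 : pi0 0 = 0.
Proof. by rewrite -(subrr 0) pi0B subrr. Qed.

Let pi0_at0 a : pi0 a 0 = 0.
Proof.
have [al _] := rep_bounded pi0_rep a.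
by have := al (- 1) 0 0; rewrite !scaleN1r oppr0 addr0 addNr.
Qed.

Let pi0Z a c x : pi0 a (c *: x) = c *: pi0 a x.
Proof.
have [al _] := rep_bounded pi0_rep a.
by rewrite -[c *: x]addr0 al pi0_at0 addr0.
Qed.

Lemma exists_noncompact_projection (bar : A -> A) (p : A) :
    real_structure bar -> rep_ker pi0 `&` (bar @` rep_ker pi0) = [set 0] ->
    is_projection p -> ~ sum_set J0 (bar @` J0) p ->
  exists2 q, is_projection q & ~ compact_operator H0 (pi0 q).
Proof.
move=> br P0_bar [pp pE] pJ; apply: contrapT => cpt.
have lift q : is_projection q -> exists2 j, J0 j & pi0 j = pi0 q.
  move=> qP; apply: pi0_lift; apply: contrapT => qc; apply: cpt.
  by exists q.
have [j jJ jE] := lift p (conj pp pE).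
have [|k kJ kE] := lift (bar p).
  by split; [rewrite -(barM br) pp|rewrite -(bar_star br) pE].
(* [p = p * p], so a product in [P0 `&` bar P0 = 0] of two elements congruent
   to [p] modulo [J0] and [bar J0] puts [p] in [J0 + bar J0]. *)
have prod0 : cmul (p - j) (p - bar k) = 0.
  suff : (rep_ker pi0 `&` (bar @` rep_ker pi0)) (cmul (p - j) (p - bar k)).
    by rewrite P0_bar.
  split.
    by apply/funext => x; rewrite pi0M pi0B jE subrr.
  (* Applying [bar] to this element returns the product, and its right factor is killed by [pi0]
     because [pi0 k = pi0 (bar p)]. *)
  exists (cmul (bar (p - j)) (bar p - k)).
    by apply/funext => x; rewrite pi0M pi0B kE subrr pi0_at0.
  rewrite (barM br) (barK br); congr cmul.
  have barN a : bar (- a) = - bar a.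
    by rewrite -scaleN1r (barZ br) rmorphN rmorph1 scaleN1r.
  by rewrite (barD br) (barK br) barN.
have cmulN a b : cmul a (- b) = - cmul a b.
  by rewrite -scaleN1r cmulZr scaleN1r.
have cmulNl a b : cmul (- a) b = - cmul a b.
  by rewrite -scaleN1r cmulZl scaleN1r.
(* Expanding [prod0] gives $p=(jp-j\overline{k})+p\overline{k}$, and
   $p\overline{k}=\overline{\overline{p}k}$ lies in $\overline{\mathcal{J}_0}$. *)
apply: pJ; exists (cmul j p - cmul j (bar k)), (cmul p (bar k)); split.
- by apply: J0D; [exact: J0r|apply: J0N; exact: J0r].
- exists (cmul (bar p) k); first exact: J0l.
  by rewrite (barM br) (barK br).
move: prod0; rewrite cmulDl !cmulDr !cmulN !cmulNl opprK pp => /eqP.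
rewrite -addrA addr_eq0 => /eqP {1}->.
by rewrite !opprD !opprK addrC.
Qed.

Lemma hdot_inj (x y : H0) : (forall z, hdot x z = hdot y z) -> x = y.
Proof.
by move=> xy; apply/eqP; rewrite -subr_eq0 -hdot_eq0 linearBl /= xy subrr.
Qed.

Lemma pi0_star_rank_one a x u :
  pi0 a = rank_one x u -> pi0 (cstar a) = rank_one u x.
Proof.
move=> aE; apply/funext => z; apply: hdot_inj => y.
rewrite (rep_star pi0_rep) cstarK aE /rank_one linearZr_LR linearZl_LR /=.
by rewrite mulrC -hdotC.
Qed.

Lemma rank_one_lift x u : hdot u u = 1 ->
  exists2 a, J0 a & pi0 a = rank_one x u.
Proof. by move=> u1; apply: pi0_lift; exact: compact_rank_one. Qed.

Variables (x0 : H0) (p : A).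
Hypotheses (x0_unit : hdot x0 x0 = 1) (pJ : J0 p).
Hypothesis pE : pi0 p = rank_one x0 x0.

Lemma star_mul_rank_one a b x y : J0 b ->
    pi0 a = rank_one x x0 -> pi0 b = rank_one y x0 ->
  cmul (cstar a) b = hdot y x *: p.
Proof.
move=> bJ aE bE; apply: pi0_inj; first exact: J0l.
  case: J0_ideal => -[_ J00 h] _.
  by have := h (hdot y x) p 0 pJ J00; rewrite addr0.
apply/funext => z; rewrite pi0M bE (pi0_star_rank_one aE).
have := rep_linear pi0_rep (hdot y x) p 0.
rewrite addr0 pi0_0 addr0 => ->; rewrite pE.
by rewrite /rank_one linearZl_LR /= mulrC -scalerA.
Qed.

(** The lift satisfies $p^*p=p$; taking adjoints gives $p^*=p$, and then $pp=p$. *)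
Lemma rank_one_projection : is_projection p.
Proof.
have pp : cmul (cstar p) p = p.
  by rewrite (star_mul_rank_one pJ pE pE) x0_unit scale1r.
have ps : cstar p = p by rewrite -{1}pp cstarM cstarK pp.
by split=> //; rewrite -{1}ps pp.
Qed.

(** If $q\le p$ then $q=pqp$ acts as a scalar multiple $c$ of the rank-one projection; $q^2=q$
    forces $c\in\{0,1\}$, and injectivity on [J0] concludes. *)
Lemma rank_one_minimal : minimal_projection p.
Proof.
have x0_neq0 : x0 != 0 by rewrite -hdot_eq0 x0_unit oner_eq0.
have px0 : pi0 p x0 = x0 by rewrite pE /rank_one x0_unit scale1r.
have [pp ps] := rank_one_projection.
split=> // [p0|q [qq qs] pq].
  by move: px0 x0_neq0; rewrite p0 pi0_0 => <-; rewrite eqxx.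
have qp : cmul q p = q by rewrite -qs -{1}ps -cstarM pq.
have qJ : J0 q by rewrite -pq; exact: J0r.
pose c := hdot (pi0 q x0) x0.
have qE z : pi0 q z = c *: pi0 p z.
  rewrite -{1}pq -{1}qp pi0M pi0M pE /rank_one.
  by rewrite pi0Z linearZl_LR /= scalerA mulrC.
have /eqP : c * c = c.
  have qx0 : pi0 q x0 = c *: x0 by rewrite qE px0.
  rewrite {3}/c -qq pi0M qx0 pi0Z qx0 scalerA linearZl_LR /=.
  by rewrite x0_unit mulr1.
rewrite -subr_eq0 -{3}[c]mulr1 -mulrBr mulf_eq0 subr_eq0.
case/orP=> /eqP c01; [left|right]; apply: pi0_inj => //; apply/funext => z.
  by rewrite qE c01 scale0r pi0_0.
by rewrite qE c01 scale1r.
Qed.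

(** The [v i] lift $x_i\otimes x_0^*$ for an orthonormal family in the range of [pi0 q], so each is
    a partial isometry from [p] to a subprojection of [q], with orthogonal ranges. *)
Lemma infinite_rank_lift (q : A) (N : nat) :
    is_projection q -> ~ compact_operator H0 (pi0 q) ->
  exists v : 'I_N -> A, (forall i, cmul q (v i) = v i) /\
    (forall i j, cmul (cstar (v i)) (v j) = (i == j)%:R *: p).
Proof.
move=> [qq qs] qnc.
have [|||x [Qx xx]] :=
    @noncompact_projection_orthonormal R H0 (pi0 q) _ _ _ qnc N.
- by have [] := rep_bounded pi0_rep q.
- by rewrite -(repM pi0_rep) qq.
- by move=> x y; rewrite (rep_star pi0_rep) qs.
have /choice[v vP] i : exists a, J0 a /\ pi0 a = rank_one (x i) x0.
  by have [a] := rank_one_lift (x i) x0_unit; exists a.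
exists v; split=> [i|i j].
  have [viJ viE] := vP i; apply: pi0_inj => //; first exact: J0l.
  by apply/funext => z; rewrite pi0M viE /rank_one pi0Z Qx.
have [_ viE] := vP i; have [vjJ vjE] := vP j.
by rewrite (star_mul_rank_one vjJ viE vjE) xx eq_sym.
Qed.

End Lifting.

(** * Matrices over the unitization with entries in $\mathcal{A}$ *)

Section Uinj.
Variables (R : realType) (A : cstarAlgType R).

Lemma uinjM (a b : A) :
  uinj a * uinj b = uinj (cmul a b) :> unitization A.
Proof.
congr pair; first exact: mulr0.
by rewrite /= !scale0r !add0r.
Qed.

Lemma star_uinj (a : A) : star (uinj a : unitization A) = uinj (cstar a).
Proof. by congr pair; exact: conjC0. Qed.

Lemma uinj_sum_isometry (q p : A) N (v : 'I_N -> A) :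
    is_projection q -> (forall i, cmul q (v i) = v i) ->
    (forall i j, cmul (cstar (v i)) (v j) = (i == j)%:R *: p) ->
  let V : 'M[unitization A]_(1, N) := \matrix_(i, j) uinj (v j) in
  (\matrix_(i < 1, j < 1) uinj q) *m V = V /\ mxadj V *m V = (uinj p)%:M.
Proof.
move=> qP qv vv V; split; apply/matrixP => i j; rewrite !mxE big_ord1 !mxE.
  by rewrite uinjM qv.
rewrite star_uinj uinjM vv; case: eqP => _ /=.
  by rewrite scale1r mulr1n.
by rewrite scale0r mulr0n.
Qed.

Lemma not_stably_finite (q p : A) (qP : is_projection q) (pP : is_projection p)
    (n : int) N (v : 'I_N -> A) :
    n < N -> K0_class qP = K0_class pP *~ n -> p <> 0 ->
    (forall i, cmul q (v i) = v i) ->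
    (forall i j, cmul (cstar (v i)) (v j) = (i == j)%:R *: p) ->
  ~ stably_finite A.
Proof.
move=> nN qn p0 qv vv fin; apply: p0.
have [qV VV] := uinj_sum_isometry qP qv vv.
have pp : uinj p * uinj p = uinj p :> unitization A by rewrite uinjM (proj1 pP).
have ps : star (uinj p : unitization A) = uinj p.
  by rewrite star_uinj (proj2 pP).
(* [K0_class] is built on a constant 1 by 1 matrix, while the $K_{00}$ argument uses scalar
   matrices; in size 1 the two agree. *)
have pE : K0_class pP = K00_class (Projection (scalar_projection 1 pp ps)).
  apply: eq_K00_class => /=.
  have <- : \matrix_(i < 1, j < 1) uinj p = (uinj p)%:M :> 'M[unitization A]_1.
    by apply/matrixP => i j; rewrite !mxE !ord1 eqxx.
  by apply: mvn_refl; exact: uinj_projection.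
rewrite pE in qn.
by have [] := mvn_infinite_rank_eq0 fin qV VV nN qn.
Qed.

End Uinj.

(** * Failure of stable finiteness when $[p]_0$ generates $K_0(\mathcal{A})$ *)

Theorem proposition2p23 (R : realType) (A : cstarAlgType R)
    (H0 : hilbertType R) (pi0 : A -> H0 -> H0) (J0 : set A) (bar : A -> A)
    (Asep : separable A)
    (pi0_rep : star_representation pi0)
    (pi0_compact : compact_operator H0 `<=` range pi0)
    (pi0_neq0 : range pi0 <> [set 0])
    (P0_open : hk_open [set rep_ker pi0])
    (J0_ideal : closed_ideal J0)
    (J0_iso : set_bij J0 (compact_operator H0) pi0)
    (A_real : real_structure bar)
    (P0_bar : rep_ker pi0 `&` (bar @` rep_ker pi0) = [set 0])
    (K0_gen : forall (p : A) (pP : is_projection p),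
        J0 p -> minimal_projection p ->
        K0 A = [set K0_class pP *~ n | n in [set: int]])
    (proj_out : exists2 p : A,
        is_projection p & ~ sum_set J0 (bar @` J0) p) :
  ~ stably_finite A.
Proof.
have [p' p'P p'J] := proj_out.
have [q qP qnc] :=
  exists_noncompact_projection pi0_rep J0_ideal J0_iso A_real P0_bar p'P p'J.
(* An orthonormal family of length 1 supplies a unit vector of [H0], from which the minimal
   projection [p] is lifted. *)
have [|||x [_ xx]] :=
    @noncompact_projection_orthonormal R H0 (pi0 q) _ _ _ qnc 1%N.
- by have [] := rep_bounded pi0_rep q.
- by rewrite -(repM pi0_rep) (proj1 qP).
- by move=> y z; rewrite (rep_star pi0_rep) (proj2 qP).
have x1 : hdot (x ord0) (x ord0) = 1 by rewrite xx eqxx.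
have [p pJ pE] := rank_one_lift J0_iso (x ord0) x1.
have pP := rank_one_projection pi0_rep J0_ideal J0_iso x1 pJ pE.
have pmin := rank_one_minimal pi0_rep J0_ideal J0_iso x1 pJ pE.
have := K0_class_in qP; rewrite (K0_gen p pP pJ pmin) => -[n _ nE].
(* The number of copies $|n|+1$ exceeds [n] whatever its sign. *)
have [v [qv vv]] := infinite_rank_lift pi0_rep J0_ideal J0_iso x1 pJ pE
  `|n|.+1 qP qnc.
apply: (not_stably_finite _ (esym nE) _ qv vv); last by case: pmin.
by rewrite (le_lt_trans (ler_norm n)) // -abszE ltz_nat.
Qed.
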